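(* Let $n \ge 2$ and let $B_n = (k_1+1, k_2+1, \ldots, k_n+1)$ be a bouquet of $n$ circles with a cut-vertex. Then $Z(L(B_n)) = 2n-1$.
   Context: For integers $k_n \ge \cdots \ge k_1 \ge 2$, the bouquet $B_n = (k_1+1, \ldots, k_n+1)$ is the graph obtained from $n$ cycles $C^1, \ldots, C^n$, where $C^i$ has $k_i+1$ vertices, by identifying one vertex from each cycle into a single common vertex (so the cycles pairwise share only that vertex). $L(G)$ is the line graph of $G$. Zero forcing: each vertex of a graph $H$ is colored black or white; if a black vertex $u$ has exactly one white neighbor $w$, then $w$ becomes black (color-change rule). $S \subseteq V(H)$ is a zero forcing set if, starting with exactly $S$ black, repeated application of the rule makes every vertex black. $Z(H)$ is the minimum size of a zero forcing set of $H$. *)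

(* Defs.v *)
From HB Require Import structures.
From mathcomp Require Import all_boot.

Set Implicit Arguments.
Unset Strict Implicit.
Unset Printing Implicit Defensive.

Record sgraph := SGraph {
  vertex :> finType;
  adj : rel vertex;
  adj_sym : symmetric adj;
  adj_irrefl : irreflexive adj
}.

Arguments adj {s}.

Section LineGraph.
Variable G : sgraph.

Definition edges : {set {set G}} :=
  [set [set p.1; p.2] | p : G * G & adj p.1 p.2].

Definition edge_type : finType := {e : {set G} | e \in edges}.

Definition line_adj : rel edge_type :=
  fun e f => (e != f) && (val e :&: val f != set0).

Lemma line_adj_sym : symmetric line_adj.
Proof. by move=> e f; rewrite /line_adj eq_sym setIC. Qed.

Lemma line_adj_irrefl : irreflexive line_adj.
Proof. by move=> e; rewrite /line_adj eqxx. Qed.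

Definition line_graph : sgraph := SGraph line_adj_sym line_adj_irrefl.

End LineGraph.

Section ZeroForcing.
Variable G : sgraph.

(* With B the set of black vertices, u is black and w is its only white
   neighbor. *)
Definition forces (B : {set G}) (u w : G) : bool :=
  (u \in B) && ([set v | adj u v & v \notin B] == [set w]).

Definition color_change : rel {set G} :=
  fun B B' => [exists u, exists w, forces B u w && (B' == w |: B)].

Definition zero_forcing_set (S : {set G}) : bool :=
  connect color_change S [set: G].

(* The seed [set: G] of the arg min is itself zero forcing, by
   connect0. *)
Definition zero_forcing_number : nat :=
  #|[arg min_(S < [set: G] | zero_forcing_set S) #|S|]|.

End ZeroForcing.

Section Cycle.
Variable m : nat.

(* This is the cycle with m vertices when m >= 3. The inequality only matters
   for m = 1, where it excludes a loop. *)
Definition cycle_adj : rel 'I_m :=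
  fun a b => (a != b) &&
    ((b == a.+1 %[mod m]) || (a == b.+1 %[mod m])).

Lemma cycle_adj_sym : symmetric cycle_adj.
Proof. by move=> a b; rewrite /cycle_adj eq_sym orbC. Qed.

Lemma cycle_adj_irrefl : irreflexive cycle_adj.
Proof. by move=> a; rewrite /cycle_adj eqxx. Qed.

Definition cycle_graph : sgraph := SGraph cycle_adj_sym cycle_adj_irrefl.

End Cycle.

Section Bouquet.
Variables (n : nat) (k : 'I_n -> nat).

(* None is the common vertex; Some (Tagged _ j), with j : 'I_(k i), is one of
   the k i remaining vertices of the i-th cycle. *)
Definition bouquet_vertex : finType := option {i : 'I_n & 'I_(k i)}.

(* The map from the i-th cycle to the bouquet under which the vertices 0 of all
   the cycles are identified. *)
Definition petal (i : 'I_n) (a : cycle_graph (k i).+1) : bouquet_vertex :=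
  omap (fun j : 'I_(k i) => Tagged (fun i => 'I_(k i)) j) (unlift ord0 a).

Lemma petal_inj i : injective (@petal i).
Proof.
move=> a b; rewrite /petal.
case: unliftP => [a' ->|->]; case: unliftP => [b' ->|->] //= [].
by move/eqP; rewrite eq_Tagged /= => /eqP ->.
Qed.

Definition bouquet_adj : rel bouquet_vertex :=
  fun x y => [exists i, exists a, exists b : cycle_graph (k i).+1,
    [&& adj a b, x == petal a & y == petal b]].

Lemma bouquet_adj_sym : symmetric bouquet_adj.
Proof.
suff sub x y : bouquet_adj x y -> bouquet_adj y x.
  by move=> x y; apply/idP/idP; apply: sub.
case/existsP=> i; case/existsP=> a; case/existsP=> b; case/and3P=> ab xa yb.
apply/existsP; exists i; apply/existsP; exists b; apply/existsP; exists a.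
by rewrite adj_sym ab yb xa.
Qed.

Lemma bouquet_adj_irrefl : irreflexive bouquet_adj.
Proof.
move=> x; apply/negbTE/negP => /existsP [i]; case/existsP=> a; case/existsP=> b.
by case/and3P=> ab /eqP -> /eqP /petal_inj ab'; rewrite ab' adj_irrefl in ab.
Qed.

Definition bouquet : sgraph := SGraph bouquet_adj_sym bouquet_adj_irrefl.

End Bouquet.

(* Main.v *)
Require Import Defs.
From mathcomp Require Import all_boot.
From mathcomp Require Import zify.

(** The line graph of the bouquet is a clique on the [2n] edges at the common
    vertex, together with one path per petal joining the two clique vertices of
    that petal.
    Lower bound: as long as no vertex of a clique [K] has forced, every forcing
    chain meets [K] in at most its tip, so [K] has at most [#|S|] black
    vertices; when a vertex of [K] forces for the first time, at most one
    vertex of [K] is white. Hence [#|K| - 1 <= #|S|] for every clique [K].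
    Upper bound: take the first two edges of one petal, and all edges at the
    common vertex except the last one of that petal and one of another petal.
    The forcing runs along the first petal, its first edge then completes the
    clique, and after that every other petal is forced from its first edge. *)

Set Implicit Arguments.
Unset Strict Implicit.
Unset Printing Implicit Defensive.

(** * Zero forcing in an arbitrary graph: stalled sets and the clique bound *)

Section ZeroForcingBounds.
Variable G : sgraph.
Implicit Types (B S K T : {set G}) (u v w : G).

(** No force is possible from [B], phrased positively so that it directly yields that [w] is
    black. *)
Definition stalled B : Prop :=
  forall u w, u \in B -> adj u w ->
    (forall v, adj u v -> v != w -> v \in B) -> w \in B.

(** Forcing as long as possible ends in a stalled superset of [S], so no order of forces has to be
    exhibited. *)
Lemma zero_forcing_stalled S :
  (forall B, S \subset B -> stalled B -> B = setT) -> zero_forcing_set S.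
Proof.
move=> stalledT; rewrite /zero_forcing_set.
suff H m B : #|~: B| <= m -> S \subset B -> connect (@color_change G) B setT.
  exact: (H _ S (leqnn _)).
elim: m B => [|m IHm] B leBm sSB.
  by rewrite -(setCK B) (cards0_eq (A := ~: B)) ?setC0 ?connect0 //; lia.
case: (boolP [exists u, exists w, forces B u w]) => [/existsP[u /existsP[w uw]]|].
  have wB : w \notin B.
    have /andP[_ /eqP/setP/(_ w)] := uw.
    by rewrite !inE eqxx => /andP[].
  apply: (connect_trans (y := w |: B)).
    apply: connect1; apply/existsP; exists u; apply/existsP; exists w.
    by rewrite uw eqxx.
  apply: IHm; last exact: subset_trans sSB (subsetUr _ _).
  have := cardsC B; have := cardsC (w |: B); rewrite cardsU1 wB; lia.
move=> noforce; rewrite (stalledT B sSB) ?connect0 // => u w uB uw nbr.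
apply: contraNT noforce => wB.
apply/existsP; exists u; apply/existsP; exists w; rewrite /forces uB /=.
apply/eqP/setP => v; rewrite !inE; apply/andP/eqP => [[uv]|->]; last by [].
by apply: contraNeq => /(nbr _ uv).
Qed.

(* [T] is the set of tips of the forcing chains. *)
Definition chain_tips K S B T : Prop :=
  [/\ #|T| <= #|S|, K :&: B \subset T &
      forall u v, u \in B -> u \notin T -> adj u v -> v \in B].

Lemma clique_le_zero_forcing_set K S :
  {in K &, forall u v, u != v -> adj u v} -> zero_forcing_set S ->
  #|K|.-1 <= #|S|.
Proof.
move=> clK /connectP[p pathp lastp].
suff H B T : path (@color_change G) B p -> setT = last B p ->
    chain_tips K S B T -> #|K|.-1 <= #|S|.
  apply: (H S S) => //; split=> //; first exact: subsetIr.
  by move=> u v ->.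
elim: p B T {pathp lastp} => [|B' p IHp] B T /=.
  move=> _ <- [leTS]; rewrite setIT => /subset_leq_card leKT _; lia.
case/andP=> /existsP[u /existsP[w /andP[/andP[uB /eqP white] /eqP ->]]].
move=> pathp lastp [leTS sKBT nbrB].
have [uw wB] : adj u w /\ w \notin B.
  by move/setP/(_ w): white; rewrite !inE eqxx => /andP[].
have nbr v : adj u v -> v != w -> v \in B.
  by move=> uv; apply: contraNT => vB; move/setP/(_ v): white; rewrite !inE uv vB => <-.
case: (boolP (u \in K)) => uK.
  (* First force from inside [K]: each vertex of [K] other than [w] is [u] or a neighbor of [u],
     hence already black and therefore a tip. *)
  have: K :\ w \subset T.
    apply: subset_trans sKBT; apply/subsetP => v; rewrite !inE => /andP[vw vK].
    rewrite vK /=; have [->//|vu] := eqVneq v u.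
    by apply: nbr vw; apply: clK => //; rewrite eq_sym.
  by move/subset_leq_card; rewrite (cardsD1 w K); case: (w \in K) => /=; lia.
have uT : u \in T by apply: contraNT wB => uT; apply: nbrB uw.
(* The chain ending at [u] is extended to [w]. Since [u] is outside [K], no vertex of [K] stops
   being a tip. *)
apply: IHp (w |: (T :\ u)) pathp lastp _; split.
- by move: leTS; rewrite (cardsD1 u T) uT cardsU1; case: (_ \notin _) => /=; lia.
- apply/subsetP => v; rewrite !inE; case: eqVneq => //= vw /andP[vK vB].
  rewrite (subsetP sKBT) ?inE ?vK // andbT.
  by apply: contraNneq uK => <-.
move=> v x; rewrite !inE negb_or; case: eqVneq => //= vw vB.
rewrite negb_and negbK => /orP[/eqP->|vT] vx; last by rewrite (nbrB v) ?orbT.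
by case: eqVneq => //= xw; apply: nbr.
Qed.

Lemma zero_forcing_number_eq m :
  (forall S, zero_forcing_set S -> m <= #|S|) ->
  (exists2 S : {set G}, zero_forcing_set S & #|S| <= m) ->
  zero_forcing_number G = m.
Proof.
move=> lb [S zS leSm]; rewrite /zero_forcing_number.
case: arg_minnP => [|T zT minT]; first exact: connect0.
by apply/eqP; rewrite eqn_leq lb // (leq_trans (minT _ zS)).
Qed.

End ZeroForcingBounds.

(** * The edges of the bouquet, enumerated along its petals *)

Section BouquetLineGraph.
Variables (n : nat) (k : 'I_n -> nat) (k_ge2 : forall i : 'I_n, 2 <= k i).
Local Notation H := (line_graph (bouquet k)).
Implicit Types (i j : 'I_n) (a b : nat) (e f : H) (B : {set H}).

(* Position [a] on the closed walk around petal [i]: both [0] and [(k i).+1]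
   denote the common vertex. *)
Definition walk i a : bouquet k :=
  if a is c.+1 then
    omap (fun j : 'I_(k i) => Tagged (fun i => 'I_(k i)) j) (insub c)
  else None.

Lemma walk_end i : walk i (k i).+1 = None.
Proof. by rewrite /walk insubF ?ltnn. Qed.

(** The bound on [a] keeps away from the common vertex, which lies on every petal; [b] is free
    because every non-interior position is sent to [None]. *)
Lemma walk_inj i j a b : 0 < a <= k i -> walk i a = walk j b -> i = j /\ a = b.
Proof.
case: a => [//|c] /= ltc; rewrite insubT; case: b => [//|d] /=.
case: insubP => //= y _ <-.
by move/(congr1 (omap (fun x : {i : 'I_n & 'I_(k i)} => (tag x, val (tagged x))))) => [-> ->].
Qed.

Lemma petal_walk i (a : cycle_graph (k i).+1) : petal a = walk i a.
Proof.
rewrite /petal; case: unliftP => [c ->|->] //.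
by rewrite lift0 /= valK.
Qed.

Lemma walk_modn i a : a <= (k i).+1 -> walk i (a %% (k i).+1) = walk i a.
Proof.
rewrite leq_eqVlt => /orP[/eqP->|lta]; last by rewrite modn_small.
by rewrite modnn walk_end.
Qed.

Lemma petal_edge_subproof i (a : 'I_(k i).+1) :
  [set walk i a; walk i a.+1] \in edges (bouquet k).
Proof.
apply/imsetP; exists (walk i a, walk i a.+1) => //.
rewrite inE; apply/existsP; exists i; apply/existsP; exists a.
apply/existsP; exists (ordS a); rewrite !petal_walk /= walk_modn // !eqxx !andbT.
rewrite /cycle_adj /= modn_mod eqxx /= andbT; apply/eqP => /(congr1 val) /=.
have := k_ge2 i; have := ltn_ord a; rewrite leq_eqVlt => /orP[/eqP[->]|lta].
  by rewrite modnn; lia.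
by rewrite modn_small //; lia.
Qed.

(* Meaningful for [a <= k i] only: [inord] sends larger [a] to a default. *)
Definition petal_edge i a : H :=
  Sub [set walk i (inord a : 'I_(k i).+1); walk i (inord a : 'I_(k i).+1).+1]
      (petal_edge_subproof (inord a)).

Lemma val_petal_edge i a :
  a <= k i -> val (petal_edge i a) = [set walk i a; walk i a.+1].
Proof. by move=> lea; rewrite /= inordK. Qed.

Lemma petal_edgeP e : exists i a, a <= k i /\ e = petal_edge i a.
Proof.
suff [i [a [lea Ee]]] : exists i a, a <= k i /\ val e = [set walk i a; walk i a.+1].
  by exists i, a; split=> //; apply: val_inj; rewrite val_petal_edge.
have /imsetP[[x y]] := valP e; rewrite inE /= => xy ->.
case/existsP: xy => i /existsP[a /existsP[b /and3P[ab /eqP-> /eqP->]]].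
have walkE (c d : 'I_(k i).+1) :
    d == c.+1 %[mod (k i).+1] -> walk i d = walk i c.+1.
  by move/eqP; rewrite modn_small // => ->; rewrite walk_modn.
rewrite !petal_walk; case/andP: ab => _ /orP[/walkE->|/walkE->].
  by exists i, a; rewrite -ltnS.
by exists i, b; rewrite -ltnS setUC.
Qed.

(** Vertices other than the common one have degree two. *)
Lemma walk_in_edge i a e : 0 < a <= k i -> walk i a \in val e ->
  e = petal_edge i a.-1 \/ e = petal_edge i a.
Proof.
move=> ia; have [j [b [leb ->]]] := petal_edgeP e.
rewrite val_petal_edge // !inE.
by case/orP=> /eqP /(walk_inj ia)[-> ->]; [right|left].
Qed.

Lemma line_adj_shared e f :
  adj e f -> exists2 x, x \in val e & x \in val f.
Proof.
by case/andP=> _ /set0Pn[x]; rewrite inE => /andP[]; exists x.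
Qed.

Lemma line_adjI e f x : e != f -> x \in val e -> x \in val f -> adj e f.
Proof.
by move=> ef xe xf; apply/andP; split=> //; apply/set0Pn; exists x; apply/setIP.
Qed.

Lemma petal_edge_adjS i a : a < k i -> adj (petal_edge i a) (petal_edge i a.+1).
Proof.
move=> lta; apply: (@line_adjI _ _ (walk i a.+1)).
- apply/eqP => /(congr1 val); rewrite !val_petal_edge // 1?ltnW //.
  (* The separating vertex must be interior for [walk_inj]: position [2] for the first pair of
     edges, the near end of the earlier edge otherwise. *)
  case: a lta => [|a] lta /setP.
    move/(_ (walk i 2)); rewrite !inE eqxx orbT => /orP[]/eqP/walk_inj[] //;
    by rewrite k_ge2.
  move/(_ (walk i a.+1)); rewrite !inE eqxx => /esym /orP[]/eqP/walk_inj[];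
    by [rewrite // ltnW | lia].
- by rewrite val_petal_edge 1?ltnW // !inE eqxx orbT.
- by rewrite val_petal_edge // !inE eqxx.
Qed.

(** An edge with two interior ends is adjacent only to its predecessor and successor, so two
    consecutive black edges advance along the petal. *)
Lemma stalled_petal B i a : stalled B ->
  petal_edge i 0 \in B -> petal_edge i 1 \in B -> a <= k i -> petal_edge i a \in B.
Proof.
move=> stB B0 B1; suff H c : c < k i -> petal_edge i c \in B /\ petal_edge i c.+1 \in B.
  by case: a => // a /H[].
elim: c => // c IHc ltc; have [Bc BSc] := IHc (ltnW ltc); split=> //.
apply: (stB _ _ BSc (petal_edge_adjS ltc)) => f /line_adj_shared[x].
rewrite val_petal_edge 1?ltnW // !inE => /orP[]/eqP-> xf fne.
  by case: (walk_in_edge _ xf) => [|->|->] /=; first exact: ltnW.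
case: (walk_in_edge _ xf) => [|->|Ef] //.
by rewrite Ef eqxx in fne.
Qed.

(** * The clique of edges at the common vertex *)

Definition star : {set H} := [set e : H | (None : bouquet k) \in val e].

Definition star_edge (p : 'I_n * bool) : H :=
  petal_edge p.1 (if p.2 then k p.1 else 0).

Lemma val_star_edge p : val (star_edge p) =
  [set None; walk p.1 (if p.2 then k p.1 else 1)].
Proof.
case: p => i []; rewrite /star_edge val_petal_edge //.
by rewrite walk_end setUC.
Qed.

(** The interior end of a star edge determines its petal and, as [1 < k i], which of the two star
    edges of that petal it is. *)
Lemma star_edge_inj : injective star_edge.
Proof.
move=> [i b] [j c] /(congr1 val); rewrite !val_star_edge /=.
set x := if b then _ else _; set y := if c then _ else _.
have ix : 0 < x <= k i by have := k_ge2 i; rewrite /x; case: b {x y}; lia.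
move/setP/(_ (walk i x)); rewrite !inE eqxx orbT => /esym/orP[/eqP|/eqP].
  by rewrite -[None]/(walk j 0) => /(walk_inj ix)[_ x0]; rewrite x0 in ix.
case/(walk_inj ix)=> ij; rewrite /x /y {x y ix} -ij; have := k_ge2 i.
by case: b; case: c => //; lia.
Qed.

Lemma starE : star = star_edge @: setT.
Proof.
apply/setP => e; rewrite inE; apply/idP/imsetP => [|[p _ ->]]; last first.
  by rewrite val_star_edge !inE.
have [i [a [lea ->]]] := petal_edgeP e; rewrite val_petal_edge // !inE.
case: a lea => [|a] lea /orP[]/eqP Na.
- by exists (i, false).
- by exists (i, false).
- by have [] : i = i /\ a.+1 = 0 by apply: walk_inj; rewrite ?lea // -Na.
have [lta|gea] := ltnP a.+1 (k i).
  by have [] : i = i /\ a.+2 = 0 by apply: walk_inj; rewrite ?lta // -Na.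
by exists (i, true); rewrite // /star_edge /= (_ : k i = a.+1) //; lia.
Qed.

Lemma star_edge_in p : star_edge p \in star.
Proof. by rewrite starE imset_f. Qed.

Lemma card_star : #|star| = 2 * n.
Proof.
by rewrite starE card_imset ?cardsT ?card_prod ?card_ord ?card_bool 1?mulnC //;
   apply: star_edge_inj.
Qed.

Lemma star_clique : {in star &, forall e f, e != f -> adj e f}.
Proof. by move=> e f; rewrite !inE => eN fN /line_adjI; apply; eassumption. Qed.

(** Serves two forces by the first edge of a petal: of [petal_edge i 1] once the star is black, and
    of the last white star edge once [petal_edge i 1] is black. *)
Lemma adj_first_edge i e :
  adj (petal_edge i 0) e -> e != petal_edge i 1 -> e \in star.
Proof.
case/line_adj_shared=> x; rewrite val_petal_edge // in_set2.
case/orP=> /eqP-> xe ne1; first by rewrite in_set.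
case: (walk_in_edge _ xe) => [|->|Ee].
- exact: ltnW (k_ge2 i).
- exact: (star_edge_in (i, false)).
by rewrite Ee eqxx in ne1.
Qed.

Lemma stalled_star B : stalled B -> star \subset B -> B = setT.
Proof.
move=> stB /subsetP sB; apply/setP => e; rewrite inE.
have [i [a [lea ->]]] := petal_edgeP e.
have B0 : petal_edge i 0 \in B by apply/sB/(star_edge_in (i, false)).
apply: stalled_petal => //; apply: (stB _ _ B0).
  exact/petal_edge_adjS/ltnW.
by move=> f /adj_first_edge fstar /fstar /sB.
Qed.

(** * A zero forcing set for the upper bound *)

Definition star_seed i j : {set H} :=
  petal_edge i 1 |: (star :\ star_edge (i, true)) :\ star_edge (j, true).

Lemma card_star_seed i j : i != j -> #|star_seed i j| <= 2 * n - 1.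
Proof.
move=> ij.
have jS : star_edge (j, true) \in star :\ star_edge (i, true).
  by rewrite in_setD1 star_edge_in (inj_eq star_edge_inj) xpair_eqE eq_sym (negbTE ij).
rewrite cardsU1 -card_star (cardsD1 (star_edge (i, true)) star) star_edge_in.
rewrite (cardsD1 (star_edge (j, true)) (star :\ _)) jS.
by case: (_ \notin _) => /=; lia.
Qed.

Lemma zero_forcing_star_seed i j : i != j -> zero_forcing_set (star_seed i j).
Proof.
move=> ij; apply: zero_forcing_stalled => B /subsetP sSB stB.
have seedB e : e \in star -> e != star_edge (i, true) ->
    e != star_edge (j, true) -> e \in B.
  by move=> eS ei ej; apply: sSB; rewrite /star_seed !in_setU1 !in_setD1 ei ej eS orbT.
have B0 : petal_edge i 0 \in B.
  by apply: (seedB (star_edge (i, false))); rewrite ?star_edge_in //;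
     rewrite (inj_eq star_edge_inj) xpair_eqE ?andbF.
have B1 : petal_edge i 1 \in B by apply: sSB; rewrite in_setU1 eqxx.
have Bi : star_edge (i, true) \in B by apply: stalled_petal.
have Bstar e : e \in star -> e != star_edge (j, true) -> e \in B.
  by move=> eS; have [-> //|/(seedB _ eS)] := eqVneq e (star_edge (i, true)).
apply: stalled_star => //; apply/subsetP => e eS.
have [->|/(Bstar _ eS) //] := eqVneq e (star_edge (j, true)).
apply: (stB _ _ B0).
  apply: (star_clique (star_edge_in (i, false)) (star_edge_in _)).
  by rewrite (inj_eq star_edge_inj) xpair_eqE andbF.
move=> f adjf; have [-> //|/(adj_first_edge adjf)] := eqVneq f (petal_edge i 1).
exact: Bstar.
Qed.

End BouquetLineGraph.

Theorem theorem3p20 (n : nat) (k : 'I_n -> nat)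
    (hn : 2 <= n)
    (hk2 : forall i : 'I_n, 2 <= k i)
    (hk : forall i j : 'I_n, i <= j -> k i <= k j) :
  zero_forcing_number (line_graph (bouquet k)) = 2 * n - 1.
Proof.
apply: zero_forcing_number_eq => [S zS|].
  by rewrite subn1 -(card_star hk2); apply: clique_le_zero_forcing_set zS;
     apply: star_clique.
(* The petals with indices [0] and [1], both available because [2 <= n]. *)
pose i := Ordinal (ltnW hn); pose j := Ordinal hn.
have ij : i != j by [].
exists (star_seed hk2 i j); first exact: zero_forcing_star_seed.
exact: card_star_seed.
Qed.
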